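(* Let $\mathbf{C}=\{0,2\}^{\mathbb{N}}$ be the Cantor set with the metric $d\big((x_n)_{n\ge1},(y_n)_{n\ge1}\big)=\sum_{n=1}^{\infty}3^{-n}|x_n-y_n|$. The map $\mathrm{mdim}_M: C^0(\mathbf{C})\to\mathbb{R}$, $\phi\mapsto\mathrm{mdim}_M(\mathbf{C},\phi,d)$, is not continuous anywhere; that is, it is discontinuous at every $\phi\in C^0(\mathbf{C})$. (This is asserted both for the lower metric mean dimension $\underline{\mathrm{mdim}_M}$ and for the upper metric mean dimension $\overline{\mathrm{mdim}_M}$.)
   Context: The sequence $(x_n)\in\{0,2\}^{\mathbb{N}}$ is identified with the point $\sum_{n\ge1}x_n3^{-n}$ of the middle third Cantor set. For a compact metric space $(X,d)$, $C^0(X)$ is the set of continuous maps $X\to X$ with the uniform metric $d(\phi,\varphi)=\max_{x\in X}d(\phi(x),\varphi(x))$. For $\phi\in C^0(X)$ and $n\ge1$ let $d_n(x,y)=\max_{0\le j\le n-1}d(\phi^j(x),\phi^j(y))$. A set $A\subset X$ is $(n,\phi,\varepsilon)$-separated if $d_n(x,y)>\varepsilon$ for all distinct $x,y\in A$; $\mathrm{sep}(n,\phi,\varepsilon)$ is the maximal cardinality of such a set, and $\mathrm{sep}(\phi,\varepsilon)=\limsup_{n\to\infty}\frac1n\log \mathrm{sep}(n,\phi,\varepsilon)$. The lower and upper metric mean dimensions are $$\underline{\mathrm{mdim}_M}(X,\phi,d)=\liminf_{\varepsilon\to0}\frac{\mathrm{sep}(\phi,\varepsilon)}{|\log\varepsilon|},\qquad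 \overline{\mathrm{mdim}_M}(X,\phi,d)=\limsup_{\varepsilon\to0}\frac{\mathrm{sep}(\phi,\varepsilon)}{|\log\varepsilon|}.$$ The symbol $\mathrm{mdim}_M$ without underline or overline means that the assertion holds for each of the two. For $X=\mathbf{C}$ both take finite values. *)

(* Defs.v *)
From HB Require Import structures.
From mathcomp Require Import all_boot all_order all_algebra finmap.
From mathcomp Require Import all_classical all_reals all_analysis.
From mathcomp Require Import lra.

Set Implicit Arguments.
Unset Strict Implicit.
Unset Printing Implicit Defensive.

Import Order.TTheory GRing.Theory Num.Def Num.Theory.
Import numFieldNormedType.Exports.

Local Open Scope classical_set_scope.
Local Open Scope ring_scope.

Section metric_mean_dimension.
Context {R : realType} {X : metricType R}.
Implicit Types (phi : X -> X) (n : nat) (eps : R).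

Definition dyn_dist phi n (x y : X) : R :=
  \big[maxr/0]_(j < n) mdist (iter j phi x) (iter j phi y).

Definition dyn_separated phi n eps (A : set X) : Prop :=
  forall x y, A x -> A y -> x != y -> eps < dyn_dist phi n x y.

(* Largest cardinality of a separated set; +oo if there is no bound (which
   cannot happen when X is compact). *)
Definition sep_card phi n eps : \bar R :=
  ereal_sup [set (#|` A|%:R)%:E | A in
    [set A : {fset X} | dyn_separated phi n eps [set` A]]].

Definition sep phi eps : \bar R :=
  limn_esup (fun n => ((n%:R)^-1)%:E * lne (sep_card phi n eps))%E.

Definition lower_mdim phi : \bar R :=
  limf_einf (fun eps : R => sep phi eps * (`|ln eps|^-1)%:E)%E 0^'+.

Definition upper_mdim phi : \bar R :=
  limf_esup (fun eps : R => sep phi eps * (`|ln eps|^-1)%:E)%E 0^'+.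

End metric_mean_dimension.

(* A point (x_n)_(n >= 1) of {0,2}^N is encoded by n |-> x_(n+1), with true
   standing for the digit 2 and false for 0. The parameter R only fixes where
   the metric takes its values. *)
Definition cantor (R : realType) : Type := nat -> bool.

HB.instance Definition _ (R : realType) := Choice.on (cantor R).
HB.instance Definition _ (R : realType) := isPointed.Build (cantor R) (fun=> false).

Section cantor_metric.
Context {R : realType}.
Implicit Types x y z : cantor R.

Definition digit (b : bool) : R := if b then 2 else 0.

Definition cantor_term x y (n : nat) : R :=
  3 ^- n.+1 * `|digit (x n) - digit (y n)|.

Definition cantor_dist x y : R := limn (series (cantor_term x y)).

Lemma cantor_term_ge0 x y n : 0 <= cantor_term x y n.
Proof. by rewrite mulr_ge0// invr_ge0 exprn_ge0. Qed.

Lemma cantor_term_le x y n : cantor_term x y n <= geometric (2 / 3) 3^-1 n.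
Proof.
have -> : geometric (2 / 3) 3^-1 n = 3 ^- n.+1 * 2 :> R.
  by rewrite /geometric/= exprVn exprS invfM -mulrA mulrC.
rewrite ler_wpM2l ?invr_ge0 ?exprn_ge0//.
by case: (x n); case: (y n); rewrite /digit ?subrr ?subr0 ?sub0r
  ?normrN ?normr0 ?ger0_norm.
Qed.

Lemma geometric3_cvg : cvgn (series (geometric (2 / 3) (3^-1 : R))).
Proof.
by apply: is_cvg_geometric_series; rewrite ger0_norm ?invf_lt1// ?ltr1n.
Qed.

Lemma cantor_series_cvg x y : cvgn (series (cantor_term x y)).
Proof.
apply: (series_le_cvg (cantor_term_ge0 x y) _ (cantor_term_le x y)) geometric3_cvg.
by move=> n; exact: le_trans (cantor_term_ge0 x y n) (cantor_term_le x y n).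
Qed.

Lemma cantor_dist_le x y :
  cantor_dist x y <= limn (series (geometric (2 / 3) (3^-1 : R))).
Proof.
apply: lim_series_le.
- exact: cantor_series_cvg.
- exact: geometric3_cvg.
- exact: cantor_term_le.
Qed.

Lemma cantor_distxx x : cantor_dist x x = 0.
Proof.
rewrite /cantor_dist (_ : series _ = cst 0) ?lim_cst//.
by apply/funext => n; apply: big1 => i _; rewrite /cantor_term subrr normr0 mulr0.
Qed.

Lemma cantor_dist_positivity x y : cantor_dist x y = 0 -> x = y.
Proof.
move=> d0; apply/funext => n.
have ndec : nondecreasing_seq (series (cantor_term x y)).
  by apply: nondecreasing_series => i _ _; exact: cantor_term_ge0.
have := nondecreasing_cvgn_le ndec (@cantor_series_cvg x y) n.+1.
rewrite -/(cantor_dist x y) d0 /series/= big_nat_recr//= => le0.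
have s0 : 0 <= \sum_(0 <= i < n) cantor_term x y i.
  by apply: sumr_ge0 => i _; exact: cantor_term_ge0.
have /eqP : cantor_term x y n = 0.
  by have := cantor_term_ge0 x y n; lra.
rewrite mulf_eq0 invr_eq0 expf_eq0/= pnatr_eq0/= normr_eq0 subr_eq0.
by case: (x n); case: (y n) => //=; rewrite /digit ?[0 == _]eq_sym pnatr_eq0.
Qed.

Lemma cantor_dist_sym x y : cantor_dist x y = cantor_dist y x.
Proof.
by congr (limn (series _)); apply/funext => n; rewrite /cantor_term distrC.
Qed.

Lemma cantor_dist_triangle y x z :
  cantor_dist x z <= cantor_dist x y + cantor_dist y z.
Proof.
have [cxy cyz] := (@cantor_series_cvg x y, @cantor_series_cvg y z).
rewrite /cantor_dist -lim_seriesD//; apply: lim_series_le.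
- exact: cantor_series_cvg.
- exact: is_cvg_seriesD.
- move=> n; rewrite [leRHS]/= /cantor_term -mulrDr.
  by apply: ler_wpM2l; [rewrite invr_ge0 exprn_ge0|exact: ler_distD].
Qed.

End cantor_metric.

HB.instance Definition _ (R : realType) := @isMetric.Build R (cantor R)
  cantor_dist cantor_distxx cantor_dist_positivity cantor_dist_sym
  cantor_dist_triangle.

Definition C0 (R : realType) : Type := continuousType (cantor R) (cantor R).

HB.instance Definition _ (R : realType) := Choice.on (C0 R).

Section uniform_metric.
Context {R : realType}.
Implicit Types phi psi : C0 R.

(* The supremum is a maximum, by compactness of the Cantor set. *)
Definition unif_dist phi psi : R :=
  sup (range (fun x : cantor R => mdist (phi x) (psi x))).

Lemma unif_dist_has_sup phi psi :
  has_sup (range (fun x : cantor R => mdist (phi x) (psi x))).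
Proof.
split; first by exists (mdist (phi point) (psi point)); exists point.
exists (limn (series (geometric (2 / 3) (3^-1 : R)))) => _ [x _ <-].
exact: cantor_dist_le.
Qed.

Lemma unif_dist_ub phi psi (x : cantor R) :
  mdist (phi x) (psi x) <= unif_dist phi psi.
Proof. by apply: ub_le_sup; [case: (unif_dist_has_sup phi psi)|exists x]. Qed.

Lemma unif_distxx phi : unif_dist phi phi = 0.
Proof.
apply/le_anti/andP; split.
  apply: ge_sup; first by case: (unif_dist_has_sup phi phi).
  by move=> _ [x _ <-]; rewrite mdistxx.
exact: le_trans (mdist_ge0 _ _) (unif_dist_ub phi phi point).
Qed.

Lemma unif_dist_positivity phi psi : unif_dist phi psi = 0 -> phi = psi.
Proof.
move=> d0; apply/continuousEP => x; apply: mdist_positivity; apply/le_anti.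
by rewrite mdist_ge0 -d0 unif_dist_ub.
Qed.

Lemma unif_dist_sym phi psi : unif_dist phi psi = unif_dist psi phi.
Proof.
by congr sup; congr image; apply/funext => x; exact: metric_sym.
Qed.

Lemma unif_dist_triangle psi phi chi :
  unif_dist phi chi <= unif_dist phi psi + unif_dist psi chi.
Proof.
apply: ge_sup; first by case: (unif_dist_has_sup phi chi).
move=> _ [x _ <-]; apply: le_trans (metric_triangle _ (psi x) _) _.
by apply: lerD; exact: unif_dist_ub.
Qed.

End uniform_metric.

HB.instance Definition _ (R : realType) := @isMetric.Build R (C0 R)
  unif_dist unif_distxx unif_dist_positivity unif_dist_sym unif_dist_triangle.

(* Main.v *)
(** Every [phi] is a uniform limit of maps whose first [k] digits depend only on
    the first [k] digits of the argument, and on the remaining digits any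
    continuous [g] may act ([splice]). A constant [g] leaves finitely many orbits
    after one step, hence mean dimension 0. If [g] is [block_shift], which acts
    on [1^j 0 C] as the [j]-th power of the shift, then at scale
    [eps = 3^-(k + 2j + 1)] there are [2^(j n)] points that are
    [(n, eps)]-separated; so [sep >= j ln 2] while [|ln eps|] is about
    [2 j ln 3], which bounds the mean dimension below by a positive constant
    independent of [k] and [phi]. Both dimensions are also bounded above, so that
    [fine] does not collapse an infinite value to 0. *)
Require Import Defs.
From mathcomp Require Import all_boot all_order all_algebra finmap.
From mathcomp Require Import all_classical all_reals all_analysis.
From mathcomp Require Import zify ring lra.

Set Implicit Arguments.
Unset Strict Implicit.
Unset Printing Implicit Defensive.

Import Order.TTheory GRing.Theory Num.Def Num.Theory.
Import numFieldNormedType.Exports.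
Local Open Scope classical_set_scope.
Local Open Scope ring_scope.

(** * Metric and continuity in terms of common prefixes *)

Section cylinders.
Context {R : realType}.
Implicit Types (x y z : cantor R) (n m k : nat).

Definition agree n x y := forall i, (i < n)%N -> x i = y i.

Lemma agree_sym n x y : agree n x y -> agree n y x.
Proof. by move=> xy i /xy. Qed.

Lemma agree_trans n y x z : agree n x y -> agree n y z -> agree n x z.
Proof. by move=> xy yz i i_n; rewrite xy// yz. Qed.

Lemma agree_le m n x y : (m <= n)%N -> agree n x y -> agree m x y.
Proof. by move=> mn xy i im; apply: xy; exact: leq_trans mn. Qed.

Lemma agree_mdist_le n x y : agree n x y -> mdist x y <= 3 ^- n :> R.
Proof.
move=> xy.
(* The remainder [3 ^- maxn n N] makes the induction close: a digit beyond [n] adds at most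
   [2 * 3 ^- N.+1 = 3 ^- N - 3 ^- N.+1]. *)
have sum3 N : \sum_(0 <= i < N) cantor_term x y i <= 3 ^- n - 3 ^- (maxn n N) :> R.
  elim: N => [|N IH]; first by rewrite big_nil maxn0 subrr.
  rewrite big_nat_recr//=; case: (ltnP N n) => Nn.
    rewrite /cantor_term xy// subrr normr0 mulr0 addr0 (le_trans IH)//.
    by rewrite (maxn_idPl (ltnW Nn)) (maxn_idPl Nn).
  rewrite (maxn_idPr (leq_trans Nn (leqnSn N))).
  rewrite (maxn_idPr Nn) in IH.
  have t : cantor_term x y N <= 3 ^- N.+1 * 2.
    rewrite ler_wpM2l ?invr_ge0 ?exprn_ge0//.
    by case: (x N); case: (y N); rewrite /digit ?subrr ?subr0 ?sub0r
      ?normrN ?normr0 ?ger0_norm.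
  have e : 3 ^- N = 3 * 3 ^- N.+1 :> R.
    by rewrite exprS invfM mulrA divff ?mul1r// pnatr_eq0.
  rewrite e in IH; lra.
apply: limr_le; first exact: cantor_series_cvg.
near=> N; apply: le_trans (sum3 N) _.
by rewrite lerBlDr lerDl invr_ge0 exprn_ge0.
Unshelve. all: by end_near. Qed.

(** The term at [n] alone contributes [2 * 3 ^- n.+1]. *)
Lemma neq_mdist_gt n x y : x n != y n -> 3 ^- n.+1 < mdist x y :> R.
Proof.
move=> xy.
have ndec : nondecreasing_seq (series (cantor_term x y)).
  by apply: nondecreasing_series => i _ _; exact: cantor_term_ge0.
have := nondecreasing_cvgn_le ndec (@cantor_series_cvg R x y) n.+1.
rewrite /series/= big_nat_recr//=; apply: lt_le_trans.
have s0 : 0 <= \sum_(0 <= i < n) cantor_term x y i.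
  by apply: sumr_ge0 => i _; exact: cantor_term_ge0.
rewrite (@lt_le_trans _ _ (cantor_term x y n))//; last by rewrite lerDr.
have -> : cantor_term x y n = 3 ^- n.+1 * 2.
  by rewrite /cantor_term; move: xy; case: (x n); case: (y n) => //= _;
    rewrite /digit ?subr0 ?sub0r ?normrN ger0_norm.
by rewrite ltr_pMr ?ltr1n// invr_gt0 exprn_gt0.
Qed.

(** A difference at some [i < n] would force a distance above [3 ^- i.+1 >= 3 ^- n]. Thus closed
    balls of radius [3 ^- n] are exactly cylinders. *)
Lemma mdist_agree n x y : mdist x y <= 3 ^- n :> R -> agree n x y.
Proof.
move=> xy i i_n; apply/eqP; apply: contraT => /neq_mdist_gt.
move=> /lt_le_trans/(_ xy); rewrite ltf_pV2 ?posrE ?exprn_gt0//.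
by rewrite ltr_eXn2l ?ltr1n// ltnNge i_n.
Qed.

Lemma expr3V_lt (e : R) : 0 < e -> exists n, 3 ^- n < e.
Proof.
move=> e0; have := @cvg_geometric R 1 3^-1.
rewrite ger0_norm ?invr_ge0// invf_lt1// ltr1n => /(_ isT).
move=> /cvgrPdist_lt/(_ e e0)[n _ /(_ n (leqnn n))]/=.
rewrite sub0r normrN mul1r exprVn ger0_norm ?invr_ge0 ?exprn_ge0// => ?.
by exists n.
Qed.

Lemma continuous_agreeP (f : cantor R -> cantor R) x :
  {for x, continuous f} <->
  forall m, exists n, forall y, agree n x y -> agree m (f x) (f y).
Proof.
split=> [cf m|H].
  have m0 : 0 < 3 ^- m :> R by rewrite invr_gt0 exprn_gt0.
  have /nbhs_ballP[d /= d0 dH] : \forall y \near x, mdist (f x) (f y) < 3 ^- m.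
    exact: metricType_numDomainType.cvgr_dist_lt cf _ m0.
  have [n nd] := expr3V_lt d0.
  exists n => y xy; apply: mdist_agree; apply: ltW; apply: dH.
  by rewrite ballEmdist/= (le_lt_trans (agree_mdist_le xy)).
apply/(@metricType_numDomainType.cvgrPdist_lt _ _ _ (nbhs x)) => e e0.
have [m me] := expr3V_lt e0; have [n nH] := H m.
apply/nbhs_ballP; exists (3 ^- n) => /=; first by rewrite invr_gt0 exprn_gt0.
move=> y; rewrite ballEmdist/= => /ltW/mdist_agree/nH/agree_mdist_le.
by move=> /le_lt_trans; exact.
Qed.

(* Koenig's lemma: if the modulus fails, nested cylinders on which it fails
   shrink to a point of discontinuity. *)
Lemma continuous_unif_agree (f : cantor R -> cantor R) m : continuous f ->
  exists n, forall x y, agree n x y -> agree m (f x) (f y).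
Proof.
move=> cf; apply: contrapT => noH.
pose bad n x := forall k, exists y y',
  [/\ agree n x y, agree n x y', agree k y y' & ~ agree m (f y) (f y')].
have bad0 x : bad 0%N x.
  move=> k; apply: contrapT => H; apply: noH; exists k => y y' yy'.
  by apply: contrapT => fyy'; apply: H; exists y, y'.
have badS n x : bad n x -> exists x', agree n x x' /\ bad n.+1 x'.
  move=> bx; apply: contrapT => H.
  pose ext b : cantor R := fun i => if i == n then b else x i.
  have ext_agree b : agree n x (ext b).
    by move=> i i_n; rewrite /ext (ltn_eqF i_n).
  have agree_ext y : agree n x y -> agree n.+1 (ext (y n)) y.
    move=> xy i; rewrite /ext; have [->//|ni] := eqVneq i n.
    by rewrite ltnS leq_eqVlt (negbTE ni)/= => /xy.
  have nbad b : ~ bad n.+1 (ext b) by move=> bb; apply: H; exists (ext b).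
  have bk b : exists k, forall y y', agree n.+1 (ext b) y ->
      agree n.+1 (ext b) y' -> agree k y y' -> agree m (f y) (f y').
    apply: contrapT => H1; apply: (nbad b) => k; apply: contrapT => H2.
    apply: H1; exists k => y y' ? ? ?; apply: contrapT => ?; apply: H2.
    by exists y, y'.
  have [[k1 H1] [k2 H2]] := (bk true, bk false).
  (* If both one-digit extensions were good, with moduli [k1] and [k2], the maximum would be a
     modulus for the parent cylinder; [n.+1] in it makes [y] and [y'] share digit [n], hence lie in
     the same extension. *)
  have [y [y' [xy xy' yy' nf]]] := bx (maxn n.+1 (maxn k1 k2)).
  have yn : y n = y' n by apply: yy'; rewrite leq_max leqnn.
  have := agree_ext _ xy; have := agree_ext _ xy'; rewrite -yn.
  case: (y n) => ey' ey; apply: nf.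
    by apply: H1 => //; apply: agree_le yy'; rewrite !leq_max leqnn !orbT.
  by apply: H2 => //; apply: agree_le yy'; rewrite !leq_max leqnn !orbT.
pose state := {p : nat * cantor R | bad p.1 p.2}.
have nextP (s : state) : exists t : state,
    agree (sval s).1 (sval s).2 (sval t).2 /\ (sval t).1 = (sval s).1.+1.
  case: s => -[n x] /= bx; have [x' [xx' bx']] := badS n x bx.
  by exists (exist _ (n.+1, x') bx').
have [next nextH] := choice nextP.
pose s n := iter n next (exist _ (0%N, point) (bad0 point)).
have s1 n : (sval (s n)).1 = n.
  by elim: n => //= n IH; rewrite (nextH _).2 IH.
have sagree n : agree n (sval (s n)).2 (sval (s n.+1)).2.
  by have := (nextH (s n)).1; rewrite s1.
have sbad n : bad n (sval (s n)).2 by have := svalP (s n); rewrite s1.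
have sagree_add n d : agree n (sval (s n)).2 (sval (s (n + d)%N)).2.
  elim: d => [|d IH]; first by rewrite addn0.
  rewrite addnS; apply: agree_trans IH _.
  by apply: agree_le (sagree _); rewrite leq_addr.
(* Digit [n] no longer changes from stage [n.+1] on, so this diagonal point lies in every cylinder
   of the chain. *)
pose z : cantor R := fun n => (sval (s n.+1)).2 n.
have zs n : agree n z (sval (s n)).2.
  move=> i i_n; rewrite /z (sagree_add i.+1 (n - i.+1)%N i (ltnSn i)).
  by rewrite subnKC.
have [n nH] := (continuous_agreeP f z).1 (cf z) m.
have [y [y' [zy zy' _]]] := sbad n 0%N; apply.
apply: agree_trans (agree_sym (nH _ _)) (nH _ _).
  exact: agree_trans (zs n) zy.
exact: agree_trans (zs n) zy'.
Qed.

End cylinders.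

(** * Bounds on upper and lower limits along a filter *)

Section limf_bounds.
Context {T : choiceType} {X : filteredType T} {R : realType}.
Implicit Types (f : X -> \bar R) (F : set_system X) (c : \bar R).
Local Open Scope ereal_scope.

Lemma limf_esup_le f F c : (\forall x \near F, f x <= c) -> limf_esup f F <= c.
Proof.
move=> fc; apply: (@le_trans _ _ (ereal_sup (f @` [set x | f x <= c]))).
  by apply: ereal_inf_lbound; exists [set x | f x <= c].
by apply: ge_ereal_sup => _ [x /= ? <-].
Qed.

Lemma limf_esup_ge f F {FF : ProperFilter F} c :
  (\forall x \near F, c <= f x) -> c <= limf_esup f F.
Proof.
move=> fc; apply: le_ereal_inf_tmp => _ [V FV <-].
have [x [Vx cx]] := filter_ex (filterI FV fc).
by apply: le_trans cx _; apply: ereal_sup_ubound; exists x.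
Qed.

Lemma limf_einf_le f F {FF : ProperFilter F} c :
  (\forall x \near F, f x <= c) -> limf_einf f F <= c.
Proof.
move=> fc; rewrite /limf_einf leeNl; apply: limf_esup_ge.
by apply: filterS fc => x ?; rewrite leeN2.
Qed.

Lemma limf_einf_ge f F {FF : Filter F} c :
  (\forall x \near F, c <= f x) -> c <= limf_einf f F.
Proof.
move=> fc; rewrite /limf_einf leeNr; apply: limf_esup_le.
by apply: filterS fc => x ?; rewrite leeN2.
Qed.

End limf_bounds.

(** * Counting separated sets and their exponential growth rate *)

Section separated_sets.
Context {R : realType} {X : metricType R}.
Implicit Types (phi : X -> X) (n N : nat) (eps : R).

(** Points with equal labels are too close, so [f] is injective on every separated set. *)
Lemma sep_card_le phi n eps (T : finType) (f : X -> T) :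
  (forall x y, f x = f y -> dyn_dist phi n x y <= eps) ->
  (sep_card phi n eps <= #|T|%:R%:E)%E.
Proof.
move=> fP; apply: ge_ereal_sup => _ [A /= sepA <-].
rewrite lee_fin ler_nat.
have : uniq (map f A).
  rewrite map_inj_in_uniq ?fset_uniq// => x y xA yA fxy.
  by apply/eqP; apply: contraT => /(sepA x y xA yA); rewrite ltNge fP.
by move/card_uniqP; rewrite size_map => <-; exact: max_card.
Qed.

Lemma sep_card_ge phi n eps (T : finType) (f : T -> X) : 0 <= eps ->
  (forall s t, s != t -> eps < dyn_dist phi n (f s) (f t)) ->
  (#|T|%:R%:E <= sep_card phi n eps)%E.
Proof.
move=> eps0 fP.
have f_inj : injective f.
  move=> s t fst; apply/eqP; apply: contraT => /fP; rewrite fst ltNge.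
  by rewrite bigmax_le// => i _; rewrite mdistxx.
apply: ereal_sup_ubound; exists (seq_fset tt (map f (enum T))).
  move=> x y xA yA.
  have /mapP[s _ ->] : x \in map f (enum T) by rewrite -(seq_fsetE tt).
  have /mapP[t _ ->] : y \in map f (enum T) by rewrite -(seq_fsetE tt).
  by move=> fst; apply: fP; apply: contraNneq fst => ->.
have f_uniq : uniq (map f (enum T)) by rewrite map_inj_uniq ?enum_uniq.
by rewrite size_seq_fset undup_id// size_map -cardE.
Qed.

Lemma sep_card_ge1 phi n eps (x : X) : 0 <= eps -> (1 <= sep_card phi n eps)%E.
Proof.
move=> eps0; rewrite -[X in (X <= _)%E]/((1%:R)%:E) -card_unit.
by apply: (sep_card_ge _ (f := fun=> x)) => // -[] [].
Qed.

Lemma sep_ge0 phi eps (x : X) : 0 <= eps -> (0 <= sep phi eps)%E.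
Proof.
move=> eps0; apply: limf_esup_ge; near=> n.
by rewrite mule_ge0 ?lee_fin ?invr_ge0// lne_ge0; exact: sep_card_ge1.
Unshelve. all: by end_near. Qed.

Lemma lne_pow2 N : lne ((2 ^ N)%:R%:E) = (N%:R * ln 2)%:E :> \bar R.
Proof.
rewrite lne_EFin ?ltr0n ?expn_gt0//.
by rewrite natrX lnXn ?ltr0n// mulr_natl.
Qed.

Lemma invn_lne_pow2 n N : (0 < n)%N ->
  (n%:R^-1%:E * lne (2 ^ (N * n))%:R%:E)%E = (N%:R * ln 2)%:E :> \bar R.
Proof.
move=> n0; rewrite lne_pow2 -EFinM natrM; congr EFin; field.
by rewrite pnatr_eq0 -lt0n.
Qed.

Lemma sep_le_pow2 phi eps N (x : X) : 0 <= eps ->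
  (forall n, (sep_card phi n eps <= (2 ^ (N * n))%:R%:E)%E) ->
  (sep phi eps <= (N%:R * ln 2)%:E)%E.
Proof.
move=> eps0 H; apply: limf_esup_le; near=> n.
have n0 : (0 < n)%N by near: n; exact: nbhs_infty_gt.
apply: (@le_trans _ _ (n%:R^-1%:E * lne (2 ^ (N * n))%:R%:E)%E).
  apply: lee_wpmul2l; first by rewrite lee_fin invr_ge0.
  rewrite lee_lne// in_itv/= ?leey ?andbT ?lee_fin//.
  by apply: (le_trans _ (sep_card_ge1 phi n x eps0)).
by rewrite invn_lne_pow2.
Unshelve. all: by end_near. Qed.

Lemma sep_ge_pow2 phi eps N :
  (forall n, ((2 ^ (N * n))%:R%:E <= sep_card phi n eps)%E) ->
  ((N%:R * ln 2)%:E <= sep phi eps)%E.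
Proof.
move=> H; apply: limf_esup_ge; near=> n.
have n0 : (0 < n)%N by near: n; exact: nbhs_infty_gt.
apply: (@le_trans _ _ (n%:R^-1%:E * lne (2 ^ (N * n))%:R%:E)%E).
  by rewrite invn_lne_pow2.
apply: lee_wpmul2l; first by rewrite lee_fin invr_ge0.
rewrite lee_lne// in_itv/= ?leey ?andbT ?lee_fin//.
by apply: le_trans (H n); rewrite lee_fin.
Unshelve. all: by end_near. Qed.

(** A bound uniform in [n] gives rates at most [N ln 2 / n], which drop below every positive [e]. *)
Lemma sep_eq0 phi eps N (x : X) : 0 <= eps ->
  (forall n, (sep_card phi n eps <= (2 ^ N)%:R%:E)%E) -> sep phi eps = 0%E.
Proof.
move=> eps0 H; apply/eqP; rewrite eq_le sep_ge0// andbT.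
apply/lee_addgt0Pr => e e0; rewrite add0e; apply: limf_esup_le; near=> n.
have n0 : (0 < n)%N by near: n; exact: nbhs_infty_gt.
apply: (@le_trans _ _ (n%:R^-1%:E * lne (2 ^ N)%:R%:E)%E).
  apply: lee_wpmul2l; first by rewrite lee_fin invr_ge0.
  rewrite lee_lne// in_itv/= ?leey ?andbT ?lee_fin//.
  by apply: (le_trans _ (sep_card_ge1 phi n x eps0)).
rewrite lne_pow2 -EFinM lee_fin mulrC ler_pdivrMr ?ltr0n// -ler_pdivrMl//.
near: n; exact: nbhs_infty_ger.
Unshelve. all: by end_near. Qed.

End separated_sets.

(** * Maps acting separately on prefix and tail *)

Section splicing.
Context {R : realType}.
Implicit Types (x y : cantor R) (f g : cantor R -> cantor R) (k m n : nat).

(** A word of length [k] is represented by its extension with [false], so that maps of the whole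
    Cantor set can be applied to it. *)
Definition trunc k x : cantor R := fun i => (i < k)%N && x i.

Definition shift k x : cantor R := fun i => x (k + i)%N.

(* The first k digits evolve by f restricted to words of length k, the
   remaining ones by g. *)
Definition splice k f g x : cantor R :=
  fun i => if (i < k)%N then f (trunc k x) i else g (shift k x) (i - k)%N.

Lemma agree_trunc k x : agree k x (trunc k x).
Proof. by move=> i ik; rewrite /trunc ik. Qed.

Lemma trunc_agree k x y : agree k x y -> trunc k x = trunc k y.
Proof. by move=> xy; apply/funext => i; rewrite /trunc; case: ltnP => // /xy. Qed.

Lemma agree_shift k n x y :
  agree (k + n)%N x y -> agree n (shift k x) (shift k y).
Proof. by move=> xy i i_n; apply: xy; rewrite ltn_add2l. Qed.

Lemma continuous_splice k f g : continuous g -> continuous (splice k f g).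
Proof.
move=> cg x; apply/continuous_agreeP => m.
have [n gn] := (continuous_agreeP g (shift k x)).1 (cg _) m.
exists (k + n)%N => y xy i im; rewrite /splice; case: ltnP => ik.
  by rewrite (@trunc_agree k x y)//; apply: agree_le xy; exact: leq_addr.
by apply: gn; [exact: agree_shift|exact: leq_ltn_trans (leq_subr _ _) im].
Qed.

(** [x] and [trunc k x] share [k] digits, which [f] turns into [m] common digits of the images. *)
Lemma agree_splice m k f g x : (m <= k)%N ->
  (forall x y, agree k x y -> agree m (f x) (f y)) ->
  agree m (f x) (splice k f g x).
Proof.
move=> mk fH i im; rewrite /splice (leq_trans im mk).
exact: fH (agree_trunc x) i im.
Qed.

Lemma card_bool_ffun n : #|{ffun 'I_n -> bool}| = (2 ^ n)%N.
Proof. by rewrite card_ffun card_bool card_ord. Qed.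

Lemma sep_splice_cst k f c (eps : R) : 0 < eps ->
  sep (splice k f (fun=> c)) eps = 0%E.
Proof.
move=> eps0; have [N0 N0e] := expr3V_lt eps0; set h := splice k f _.
have hE x y : agree k x y -> h x = h y.
  by move=> xy; apply/funext => i; rewrite /h /splice (trunc_agree xy).
pose N := maxn k N0.
apply: (@sep_eq0 _ _ _ _ N (c : cantor R) (ltW eps0)) => n.
rewrite -card_bool_ffun.
apply: (@sep_card_le _ _ _ _ _ _ (fun x : cantor R => [ffun i : 'I_N => x i])).
move=> x y /ffunP xyN.
have xy : agree N x y.
  by move=> i iN; have := xyN (Ordinal iN); rewrite !ffunE.
(* At time 0 the first [N0] digits suffice; from time 1 on the orbits coincide, since the first [k]
   digits determine the image. *)
apply: bigmax_le (ltW eps0) _ => -[[|j] jn] _ /=.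
  apply: le_trans (ltW N0e).
  by apply: agree_mdist_le; apply: agree_le xy; rewrite leq_maxr.
rewrite -!iterS !iterSr (hE x y) ?mdistxx ?(ltW eps0)//.
by apply: agree_le xy; rewrite leq_maxl.
Qed.

End splicing.

(** * The block shift and its separated orbits *)

Section block_shift.
Context {R : realType}.
Implicit Types (x y : cantor R) (k m n i j r : nat).

(* Every set 1^j 0 C of sequences with exactly j leading ones is invariant, and
   there the map is the j-th power of the shift on C, i.e., the full shift on
   2^j symbols. *)
Definition block_shift y : cantor R := fun i =>
  let j := find negb (mkseq y i.+1) in if (j < i)%N then y (i + j)%N else y i.

(** The range includes [r = j], where the prescribed value is [false]: the zero that ends the block
    of ones. *)
Definition leading_ones j y := forall r, (r <= j)%N -> y r = (r < j)%N.

(** Digit [i] of the image reads digits up to [i] to find [j], and then one at position below [2 i]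
    or at [i]. *)
Lemma continuous_block_shift : continuous block_shift.
Proof.
move=> x; apply/continuous_agreeP => m; exists (m + m)%N => y xy i im.
rewrite /block_shift.
have -> : mkseq y i.+1 = mkseq x i.+1.
  apply/eq_in_map => a; rewrite mem_iota add0n => /= ai.
  by rewrite xy//; lia.
by case: ltnP => ji; apply: xy; lia.
Qed.

Lemma leading_ones_find j y r : leading_ones j y -> (j <= r)%N ->
  find negb (mkseq y r.+1) = j.
Proof.
move=> yj jr; set c := find _ _.
have cj : (c <= j)%N.
  rewrite leqNgt; apply/negP => jc; have := before_find false jc.
  by rewrite nth_mkseq// yj// ltnn.
apply/eqP; rewrite eqn_leq cj leqNgt; apply/negP => ltcj.
have hasc : has negb (mkseq y r.+1).
  by rewrite has_find size_mkseq ltnS -/c (leq_trans cj).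
have := nth_find false hasc.
by rewrite -/c nth_mkseq ?yj ?ltcj// ltnS (leq_trans cj).
Qed.

Lemma block_shiftE j y r : leading_ones j y -> (j < r)%N ->
  block_shift y r = y (r + j)%N.
Proof.
by move=> yj jr; rewrite /block_shift (leading_ones_find yj) ?jr// ltnW.
Qed.

Lemma leading_ones_block_shift j y :
  leading_ones j y -> leading_ones j (block_shift y).
Proof.
move=> yj r rj; rewrite /block_shift; case: ltnP => [cr|_]; last exact: yj.
have hasc : has negb (mkseq y r.+1) by rewrite has_find size_mkseq ltnW.
have := nth_find false hasc; rewrite nth_mkseq; last exact: ltnW.
by rewrite yj ?(leq_trans (ltnW cr))// (leq_trans cr).
Qed.

Variables (k : nat) (f : cantor R -> cantor R).
Let h := splice k f block_shift.

Lemma shift_splice g x : shift k (splice k f g x) = g (shift k x).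
Proof.
by apply/funext => i; rewrite /shift/= /splice ltnNge leq_addr/= addKn.
Qed.

Lemma iter_splice_block_shift j x i : leading_ones j (shift k x) ->
  leading_ones j (shift k (iter i h x)) /\
  forall r, (j < r)%N -> iter i h x (k + r)%N = x (k + (r + i * j))%N.
Proof.
move=> xj; elim: i => [|i [IH1 IH2]].
  by split => // r _; rewrite mul0n addn0.
rewrite iterS; split.
  by rewrite shift_splice; exact: leading_ones_block_shift.
move=> r jr; rewrite -[LHS]/(shift k (h (iter i h x)) r) shift_splice.
rewrite (block_shiftE IH1)// /shift IH2; last by rewrite (leq_trans jr) ?leq_addr.
by congr (x _); rewrite mulSn; lia.
Qed.

(** From position [k] on this reads [1^j 0 t] followed by zeros. Subtraction is truncated, so the
    first [k] digits all equal [0 < j], whatever [t] is. *)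
Definition horseshoe_point j N (t : {ffun 'I_N -> bool}) : cantor R := fun i =>
  if (i - k <= j)%N then (i - k < j)%N else oapp t false (insub (i - k - j.+1)%N).

Lemma leading_ones_horseshoe_point j N (t : {ffun 'I_N -> bool}) :
  leading_ones j (shift k (horseshoe_point j t)).
Proof. by move=> r rj; rewrite /shift /horseshoe_point addKn rj. Qed.

Lemma sep_splice_block_shift_ge (eps : R) j :
  0 <= eps -> eps <= 3 ^- (k + j.*2.+1) ->
  ((j%:R * ln 2)%:E <= sep h eps)%E.
Proof.
move=> eps0 epsj; apply: sep_ge_pow2 => n; rewrite -card_bool_ffun.
apply: (sep_card_ge _ (f := @horseshoe_point j (j * n))) => // s t st.
have [q stq] : exists q, s q != t q.
  apply/existsP; apply: contraT; rewrite negb_exists => /forallP sE.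
  by move: st; apply: contraNT => _; apply/eqP/ffunP => q; apply/eqP/negPn/sE.
(* For [j = 0] the index type of [q] would be empty. *)
have j0 : (0 < j)%N by case: j q {s t st stq epsj} => // -[].
have qn : (q %/ j < n)%N by rewrite ltn_divLR// [ltnRHS]mulnC.
set i := Ordinal qn.
apply: lt_le_trans (le_bigmax _ _ i) => /=.
(* Each step brings the next [j] letters of the word into the window just after the terminating
   zero; letter [q] is there at time [q %/ j], at a position at most [k + 2j]. *)
have digitE (u : {ffun 'I_(j * n) -> bool}) :
    iter (q %/ j) h (horseshoe_point j u) (k + (j.+1 + q %% j))%N = u q.
  have [_ iterE] :=
    iter_splice_block_shift (q %/ j) (@leading_ones_horseshoe_point j _ u).
  rewrite iterE ?ltn_addr//.
  rewrite /horseshoe_point addKn -addnA [(q %% j + _)%N]addnC -divn_eq.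
  rewrite leqNgt ltn_addr//= addKn.
  by case: insubP => [p _ /val_inj ->//|]; rewrite ltn_ord.
have qj : (q %% j < j)%N by rewrite ltn_mod.
apply: le_lt_trans (@neq_mdist_gt R (k + (j.+1 + q %% j))%N _ _ _); last first.
  by rewrite !digitE.
apply: le_trans epsj _; rewrite lef_pV2 ?posrE ?exprn_gt0//.
by rewrite ler_eXn2l ?ltr1n//; lia.
Qed.

End block_shift.

(** * Mean dimension estimates and discontinuity *)

Section mean_dimension.
Context {R : realType}.
Implicit Types (h f : cantor R -> cantor R) (k m N : nat) (eps : R).

Lemma ln3_gt0 : 0 < ln 3 :> R.
Proof. by apply: ln_gt0; rewrite ltr1n. Qed.

Lemma ln_expr3V N : ln (3 ^- N) = - (N%:R * ln 3) :> R.
Proof. by rewrite lnV ?posrE ?exprn_gt0// lnXn// mulr_natl. Qed.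

Lemma lt_expr3V N eps : 0 < eps -> (eps < 3 ^- N) = (N%:R * ln 3 < - ln eps).
Proof.
move=> eps0; rewrite -ltr_ln ?posrE ?invr_gt0 ?exprn_gt0//.
by rewrite ln_expr3V ltrNr.
Qed.

Lemma gt_expr3V N eps : 0 < eps -> (3 ^- N < eps) = (- ln eps < N%:R * ln 3).
Proof.
move=> eps0; rewrite -ltr_ln ?posrE ?invr_gt0 ?exprn_gt0//.
by rewrite ln_expr3V ltrNl.
Qed.

(** Orbit segments are labelled by the first [N] digits of each of their [n] points; equal labels
    keep the orbits within [3 ^- N]. *)
Lemma sep_cantor_le h eps N : 3 ^- N <= eps -> (sep h eps <= (N%:R * ln 2)%:E)%E.
Proof.
move=> Neps.
have eps0 : 0 <= eps by apply: le_trans Neps; rewrite invr_ge0 exprn_ge0.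
apply: (@sep_le_pow2 _ _ _ _ N ((fun=> false) : cantor R)) => // n.
have -> : (2 ^ (N * n))%N = #|{ffun 'I_n * 'I_N -> bool}|.
  by rewrite card_ffun card_bool card_prod !card_ord mulnC.
apply: (@sep_card_le _ _ _ _ _ _
  (fun x : cantor R => [ffun p : 'I_n * 'I_N => iter p.1 h x p.2])).
move=> x y /ffunP xy; apply: bigmax_le => // j _.
apply: le_trans Neps; apply: agree_mdist_le => i iN.
by have := xy (j, Ordinal iN); rewrite !ffunE.
Qed.

Lemma sep_ratio_le h : \forall eps \near 0^'+,
  (sep h eps * (`|ln eps|^-1)%:E <= (2 * ln 2 / ln 3)%:E)%E.
Proof.
have ln30 := ln3_gt0; have ln20 : 0 < ln 2 :> R by apply: ln_gt0; rewrite ltr1n.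
near=> eps.
have eps0 : 0 < eps by near: eps; exact: nbhs_right_gt.
(* This gives [ln 3 < L], which absorbs the rounding in [K.+1] at the cost of the factor 2. *)
have : eps < 3 ^- 1 by near: eps; apply: nbhs_right_lt; rewrite invr_gt0.
rewrite lt_expr3V// mul1r => L3.
set L := - ln eps in L3 *.
have L0 : 0 < L by exact: lt_trans L3.
have -> : `|ln eps| = L by rewrite -normrN gtr0_norm.
have Ld : 0 <= L / ln 3 by rewrite divr_ge0// ltW.
have /andP[tL Lt] := truncn_itv Ld; set K := Num.truncn (L / ln 3) in tL Lt.
have KL : (K.+1)%:R * ln 3 <= 2 * L.
  by move: tL; rewrite ler_pdivlMr// -[K.+1%:R]natr1; lra.
have Keps : 3 ^- K.+1 <= eps.
  by apply: ltW; rewrite gt_expr3V// -/L -ltr_pdivrMr.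
apply: (@le_trans _ _ ((K.+1%:R * ln 2)%:E * (L^-1)%:E)%E).
  by apply: lee_wpmul2r (sep_cantor_le h Keps); rewrite lee_fin invr_ge0 ltW.
rewrite -EFinM lee_fin ler_pdivrMr// mulrAC ler_pdivlMr//.
by rewrite mulrAC [leRHS]mulrAC ler_pM2r.
Unshelve. all: by end_near. Qed.

Lemma sep_ratio_splice_block_shift_ge k f : \forall eps \near 0^'+,
  ((ln 2 / (8 * ln 3))%:E <=
   sep (splice k f block_shift) eps * (`|ln eps|^-1)%:E)%E.
Proof.
have ln30 := ln3_gt0; have ln20 : 0 < ln 2 :> R by apply: ln_gt0; rewrite ltr1n.
near=> eps.
have eps0 : 0 < eps by near: eps; exact: nbhs_right_gt.
(* Half of [L] then exceeds [(k + 4) ln 3]. With [j] the integer part of [L / (4 ln 3)], [2 j ln 3]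
   takes at most the other half, which leaves room for [k + 1]; and rounding costs [4 ln 3 < L / 2],
   so that [L <= 8 j ln 3]. *)
have : eps < 3 ^- (k.*2 + 8).
  by near: eps; apply: nbhs_right_lt; rewrite invr_gt0 exprn_gt0.
rewrite lt_expr3V// natrD -muln2 natrM => L3.
set L := - ln eps in L3 *.
have k0 : 0 <= k%:R * ln 3 :> R by rewrite mulr_ge0// ltW.
have L0 : 0 < L by lra.
have -> : `|ln eps| = L by rewrite -normrN gtr0_norm.
have Ld : 0 <= L / (4 * ln 3) by rewrite divr_ge0 ?ltW// mulr_gt0.
have /andP[jL Lj] := truncn_itv Ld; set j := Num.truncn _ in jL Lj.
move: jL Lj; rewrite ler_pdivlMr ?mulr_gt0// ltr_pdivrMr ?mulr_gt0// -[j.+1%:R]natr1 => jL Lj.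
have L8 : L <= j%:R * (8 * ln 3).
  by clear -Lj L3 k0 ln30; lra.
have epsj : eps <= 3 ^- (k + j.*2.+1).
  apply: ltW; rewrite lt_expr3V// -/L natrD -[_.+1%:R]natr1 -muln2 natrM; lra.
apply: le_trans (lee_wpmul2r _ (sep_splice_block_shift_ge f (ltW eps0) epsj));
  last by rewrite lee_fin invr_ge0 ltW.
rewrite -EFinM lee_fin ler_pdivlMr// mulrAC ler_pdivrMr ?mulr_gt0//.
by rewrite [leRHS]mulrAC [leRHS]mulrC ler_pM2l.
Unshelve. all: by end_near. Qed.

Lemma sep_ratio_splice_cst k f z : \forall eps \near 0^'+,
  (sep (splice k f (fun=> z)) eps * (`|ln eps|^-1)%:E = 0)%E.
Proof.
near=> eps; have eps0 : 0 < eps by near: eps; exact: nbhs_right_gt.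
by rewrite sep_splice_cst// mul0e.
Unshelve. all: by end_near. Qed.

Lemma unif_dist_le (phi psi : C0 R) m :
  (forall x, agree m (phi x) (psi x)) -> mdist phi psi <= 3 ^- m :> R.
Proof.
move=> H; apply: ge_sup; first by case: (unif_dist_has_sup phi psi).
by move=> _ [x _ <-]; exact: agree_mdist_le.
Qed.

(** Stated for an abstract [D] to serve both dimensions. Arbitrarily close to [phi] lie maps with
    value 0 and maps with value at least [c]; the value at [phi] cannot be within [c / 2] of
    both. *)
Lemma not_continuous_mdim (D : (cantor R -> cantor R) -> \bar R) (c C : R) :
  0 < c ->
  (forall k f z, D (splice k f (fun=> z)) = 0%E) ->
  (forall k f, (c%:E <= D (splice k f block_shift) <= C%:E)%E) ->
  forall phi : C0 R, ~ {for phi, continuous (fun psi : C0 R => fine (D psi) : R)}.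
Proof.
move=> c0 D0 Dc phi cD.
have c20 : 0 < c / 2 by rewrite divr_gt0.
have /nbhs_ballP[d /= d0 dH] :
    \forall psi \near phi, `|fine (D phi) - fine (D (psi : C0 R))| < c / 2.
  exact: (@cvgr_dist_lt _ _ _ (nbhs phi) _ _ _ cD).
have [m md] := expr3V_lt d0.
have [k0 k0H] := continuous_unif_agree m (@cts_fun _ _ phi).
(* [k0] provides the modulus of [phi]; [m] ensures that the first [m] digits are governed by [phi]
   rather than by [g]. *)
pose k := maxn m k0.
have kH x y : agree k x y -> agree m (phi x) (phi y).
  by move=> xy; apply: k0H; apply: agree_le xy; rewrite leq_maxr.
have near_splice g (cg : continuous g) :
    `|fine (D phi) - fine (D (splice k phi g))| < c / 2.
  pose psi : C0 R := mkcts (@continuous_splice R k phi g cg).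
  apply: (dH psi); rewrite ballEmdist/=; apply: le_lt_trans md.
  by apply: unif_dist_le => x; apply: agree_splice kH; exact: leq_maxl.
have := near_splice _ continuous_block_shift.
have cst_cont : continuous (fun _ : cantor R => point : cantor R).
  by move=> x; apply/continuous_agreeP => n; exists 0%N.
have := near_splice _ cst_cont.
rewrite D0/=; have := Dc k phi; case: (D (splice _ _ _)) => [r| |]//=; rewrite ?lee_fin.
  move=> /andP[cr _]; rewrite subr0 !ltr_norml => /andP[? ?] /andP[? ?]; lra.
(* The value [+oo], which [fine] would send to 0, is excluded by the bound [C]. *)
by rewrite andbF.
Qed.

End mean_dimension.

Theorem theorem4p3 (R : realType) :
  (forall phi : C0 R,
    ~ {for phi, continuous (fun psi : C0 R => fine (lower_mdim psi) : R)}) /\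
  (forall phi : C0 R,
    ~ {for phi, continuous (fun psi : C0 R => fine (upper_mdim psi) : R)}).
Proof.
have c0 : 0 < ln 2 / (8 * ln 3) :> R.
  by rewrite divr_gt0 ?mulr_gt0 ?ln3_gt0// ln_gt0// ltr1n.
split; apply: (not_continuous_mdim c0 (C := 2 * ln 2 / ln 3)) => k f.
- move=> z; have E := sep_ratio_splice_cst k f z.
  apply/eqP; rewrite eq_le; apply/andP; split.
    by apply: limf_einf_le; apply: filterS E => eps /= ->.
  by apply: limf_einf_ge; apply: filterS E => eps /= ->.
- apply/andP; split; first exact/limf_einf_ge/sep_ratio_splice_block_shift_ge.
  exact/limf_einf_le/sep_ratio_le.
- move=> z; have E := sep_ratio_splice_cst k f z.
  apply/eqP; rewrite eq_le; apply/andP; split.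
    by apply: limf_esup_le; apply: filterS E => eps /= ->.
  by apply: limf_esup_ge; apply: filterS E => eps /= ->.
- apply/andP; split; first exact/limf_esup_ge/sep_ratio_splice_block_shift_ge.
  exact/limf_esup_le/sep_ratio_le.
Qed.
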